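(* Let $X$ be an infinite Hausdorff topological space and let $H=\mathrm{USC}_p^{*}(X)$. For $\Phi=\Gamma$ (with $\tilde\Phi^{\uparrow}=\mathcal S^{\uparrow}$) the following are equivalent: (a) $H$ satisfies the selection principle $\mathrm S_1(\tilde\Phi^{\uparrow}(H),\mathcal P(H))$. (b) $X$ has the covering property $\mathrm S_1(\Phi(X),\mathcal O(X))$. (c) $H$ satisfies the selection principle $\mathrm S_1(\Phi_{\mathbf 0}(H),\mathcal O_{\mathbf 0}(H))$. (d) $H$ satisfies the selection principle $\mathrm S_1(\tilde\Phi^{\uparrow}(H),\mathcal O_{\mathbf 0}(H))$. If $X$ has the property $(\varepsilon)$, then (a)–(d) are equivalent also for $\Phi=\Omega$ (with $\tilde\Phi^{\uparrow}=\mathcal D^{\uparrow}$).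
   Context: The set ${}^X\mathbb R$ of all real functions on $X$ carries the product topology (pointwise convergence). $\mathrm{USC}_p^{*}(X)$ is the subspace of all bounded upper semicontinuous functions $f:X\to\mathbb R$ (i.e. $\{x:f(x)<a\}$ is open for every real $a$). $\mathbf 0$ is the constant zero function on $X$. Covers: an $\omega$-cover of $X$ is a cover $\mathcal U$ with $X\notin\mathcal U$ such that every finite $F\subseteq X$ is contained in some $U\in\mathcal U$. A $\gamma$-cover is an infinite cover $\mathcal U$ such that for every $x\in X$ the set $\{U\in\mathcal U:x\notin U\}$ is finite. $\mathcal O(X)$, $\Omega(X)$, $\Gamma(X)$ are the families of all open covers, open $\omega$-covers and open $\gamma$-covers. $X$ has property $(\varepsilon)$ if every open $\omega$-cover of $X$ contains a countable $\omega$-subcover. $\mathrm S_1(\mathcal A,\mathcal B)$, for families $\mathcal A,\mathcal B$ of subsets of a set: for every sequence $\langle A_n:n\in\omega\rangle$ of elements of $\mathcal A$ there are $a_n\in A_n$ ($n\in\omega$) with $\{a_n:n\in\omega\}\in\mathcal B$. For $h\in{}^X\mathbb R$ and a family $F$ of real functions on $X$: $F$ has property $(\mathcal O_h)$ if $h(x)\in\overline{\{f(x):f\in F\}}$ for every $x\in X$; $(\Omega_h)$ if $h\notin F$ and $h\in\overline F$ in ${}^X\mathbb R$; $(\Gamma_h)$ if $F$ is infinite and for every $\varepsilon>0$ and $x\in X$ the set $\{f\in F:|f(x)-h(x)|\ge\varepsilon\}$ is finite. For $H\subseteq{}^X\mathbb R$ and $\Phi\in\{\mathcal O,\Omega,\Gamma\}$,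 $\Phi_h(H)$ is the set of all $F\subseteq H$ having property $(\Phi_h)$ and such that $f\ge h$ and $f-h\in H$ for every $f\in F$. For $F\subseteq H\subseteq{}^X\mathbb R$: $\mathcal P(H)$ is the set of all $F\subseteq H$ that are pointwise dense in $\mathbb R$, i.e. $\overline{\{f(x):f\in F\}}=\mathbb R$ for each $x\in X$. $F$ is upper sequentially dense in $H$ if for every $f\in H$ there is a sequence $\langle h_n:n\in\omega\rangle$ of elements of $F$ with $h_n\to f$ pointwise, $h_n\ge f$ and $h_n-f\in H$ for all $n$. $F$ is upper dense in $H$ if for every $f\in H$ the set $\{h\in F:h\ge f\wedge h-f\in H\}$ is dense in $\{h\in H:h\ge f\}$. $\mathcal S^{\uparrow}(H)$, $\mathcal D^{\uparrow}(H)$ are the sets of all upper sequentially dense, resp. upper dense, subsets of $H$. *)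

(* Defs.v *)
From HB Require Import structures.
From mathcomp Require Import all_boot all_order all_algebra.
From mathcomp Require Import all_classical all_reals all_analysis.

Set Implicit Arguments.
Unset Strict Implicit.
Unset Printing Implicit Defensive.

Import Order.TTheory GRing.Theory Num.Theory.
Import numFieldNormedType.Exports.
Local Open Scope classical_set_scope.
Local Open Scope ring_scope.

Definition selection_S1 (T : Type) (A B : set (set T)) : Prop :=
  forall An : nat -> set T, (forall n, A (An n)) ->
    exists a : nat -> T, (forall n, An n (a n)) /\ B (range a).

Section Covers.
Variable X : topologicalType.
Implicit Types U V : set (set X).

Definition is_cover U : Prop := \bigcup_(A in U) A = [set: X].

Definition open_family U : Prop := forall A, U A -> open A.

Definition omega_cover U : Prop :=
  [/\ is_cover U, ~ U [set: X] &
      forall F : set X, finite_set F -> exists2 A, U A & F `<=` A].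

Definition gamma_cover U : Prop :=
  [/\ is_cover U, infinite_set U &
      forall x : X, finite_set [set A | U A /\ ~ A x]].

Definition open_covers : set (set (set X)) :=
  [set U | open_family U /\ is_cover U].

Definition open_omega_covers : set (set (set X)) :=
  [set U | open_family U /\ omega_cover U].

Definition open_gamma_covers : set (set (set X)) :=
  [set U | open_family U /\ gamma_cover U].

Definition property_epsilon : Prop :=
  forall U, open_omega_covers U ->
    exists V, [/\ V `<=` U, countable V & omega_cover V].

End Covers.

Arguments open_covers : clear implicits.
Arguments open_omega_covers : clear implicits.
Arguments open_gamma_covers : clear implicits.
Arguments property_epsilon : clear implicits.

Section FunctionFamilies.
Variables (R : realType) (X : Type).
Implicit Types (f g h : X -> R) (F H : set (X -> R)).

Definition le_pointwise f g : Prop := forall x, f x <= g x.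

(* The product topology has to be named explicitly: MathComp-Analysis also has
   the topology of uniform convergence on function types. *)
Definition closure_p F : set (X -> R) := @closure {ptws X -> R} F.

Definition property_O h F : Prop :=
  forall x, closure [set f x | f in F] (h x).

Definition property_Omega h F : Prop := ~ F h /\ closure_p F h.

Definition property_Gamma h F : Prop :=
  infinite_set F /\
  forall (e : R) (x : X), 0 < e ->
    finite_set [set f | F f /\ e <= `|f x - h x|].

Definition families (P : (X -> R) -> set (X -> R) -> Prop) h H :
    set (set (X -> R)) :=
  [set F | [/\ F `<=` H, P h F &
     forall f, F f -> le_pointwise h f /\ H (f \- h)]].

Definition O_families := families property_O.
Definition Omega_families := families property_Omega.
Definition Gamma_families := families property_Gamma.

Definition pointwise_dense H : set (set (X -> R)) :=
  [set F | F `<=` H /\ forall x, closure [set f x | f in F] = [set: R]].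

Definition upper_seq_dense H : set (set (X -> R)) :=
  [set F | F `<=` H /\
    forall f, H f -> exists h_ : nat -> X -> R,
      [/\ forall n, F (h_ n),
          forall x, h_ n x @[n --> \oo] --> f x &
          forall n, le_pointwise f (h_ n) /\ H (h_ n \- f)]].

Definition upper_dense H : set (set (X -> R)) :=
  [set F | F `<=` H /\
    forall f, H f ->
      [set h | H h /\ le_pointwise f h] `<=`
      closure_p [set h | [/\ F h, le_pointwise f h & H (h \- f)]]].

End FunctionFamilies.

Definition USC_bounded (R : realType) (X : topologicalType) : set (X -> R) :=
  [set f : X -> R | bounded_fun f /\ forall a : R, open [set x | f x < a]].

(* Main.v *)
Require Import Defs.
From HB Require Import structures.
From mathcomp Require Import finmap lra.
From mathcomp Require Import all_boot all_order all_algebra.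
From mathcomp Require Import all_classical all_reals all_analysis.

(**
For a cover [U], let [high_off U] be the set of all [h] in [USC*] with [h >= 1]
off some member of [U].  Raising a given [f] by a large constant off [V] in [U]
shows that [high_off U] is upper (sequentially) dense when [U] is an omega-
(gamma-) cover; a selection that is pointwise dense then takes at each point a
value [< 1], so the corresponding members of [U] cover.  Conversely, the
sublevel sets [f < e], for [f] in a family clustering at 0, form a cover of the
required kind unless one of them is the whole space, in which case that [f]
alone serves for [e].  Splitting the sequence of families into countably many
infinite subsequences allows every [e = 1/k], or every rational target value,
to be treated separately.  An upper dense set contains a family clustering at 0
(if it contains 0 itself, selecting 0 once suffices), and upper density is
invariant under translation by constants, so 0 can be replaced by any rational.
*)

Set Implicit Arguments.
Unset Strict Implicit.
Unset Printing Implicit Defensive.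

Import Order.TTheory GRing.Theory Num.Theory.
Import numFieldNormedType.Exports.
Local Open Scope classical_set_scope.
Local Open Scope ring_scope.

(** * Finite sets, countable splitting and the closure for pointwise convergence *)

Lemma near_notin_finite_set (S : set nat) :
  finite_set S -> \forall n \near \oo, ~ S n.
Proof.
move=> /finite_fsetP[D ->].
exists (\max_(i <- finmap.enum_fset D) i).+1 => //= n /= Dn nD.
move: Dn; rewrite ltnNge.
by rewrite (@leq_bigmax_seq _ (finmap.enum_fset D) xpredT id n).
Qed.

Lemma bounded_fun_ex (R : realType) (X : Type) (f : X -> R) :
  bounded_fun f <-> exists M, forall x, `|f x| <= M.
Proof.
split=> [/pinfty_ex_gt0[M _ fM]|[M fM]]; first by exists M => x; exact: fM.
exists M; split=> [|y My x _]; first exact: num_real.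
exact: le_trans (fM x) (ltW My).
Qed.

Lemma choice2 (T U : Type) (P Q : T -> U -> Prop) :
  (forall x, exists2 y, P x y & Q x y) ->
  exists f : T -> U, forall x, P x (f x) /\ Q x (f x).
Proof.
move=> PQ; have [x|f fP] := @choice T U (fun x y => P x y /\ Q x y).
  by have [y] := PQ x; exists y.
by exists f.
Qed.

(** The indices [pickle (i, m)] form pairwise disjoint subsequences, one for each [i], and the
    principle for [Q i] is applied along the [i]-th. The other subsequences contribute uncontrolled
    values, so [Q i] is obtained for a subset of the range. *)
Lemma selection_countable (I : countType) (i0 : I) (T : Type)
    (D : set (set T)) (Q : I -> set T -> Prop) :
  (forall i, selection_S1 D (Q i)) ->
  forall A : nat -> set T, (forall n, D (A n)) ->
    exists2 a : nat -> T, (forall n, A n (a n)) &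
      forall i, exists2 B, B `<=` range a & Q i B.
Proof.
move=> DQ A DA.
have [a aP] :=
  choice (fun i => DQ i (fun m => A (pickle (i, m))) (fun m => DA _)).
(* [c] fills the indices that code no pair; the principle at [i0] provides it. *)
have [c [Ac _]] := DQ i0 A DA.
exists (fun n => if pickle_inv n is Some (i, m) then a i m else c n).
  move=> n; case E : (pickle_inv n) => [[i m]|//].
  have <- : pickle (i, m) = n by have := @pickle_invK (I * nat)%type n; rewrite E.
  by have [+ _] := aP i; exact.
move=> i; exists (range (a i)); last by have [] := aP i.
by move=> _ [m _ <-]; exists (pickle (i, m)) => //; rewrite pickleK_inv.
Qed.

Lemma closure_pP (R : realType) (X : topologicalType)
    (F : set (X -> R)) (h : X -> R) :
  closure_p F h <-> forall S e, finite_set S -> 0 < e ->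
    exists2 f, F f & forall x, S x -> `|f x - h x| < e.
Proof.
rewrite /closure_p closureEcvg; split=> [+ S e /finite_fsetP[D ->] e0|Fh].
  move=> [G PG [/pointwise_cvgP Gh GF]].
  have GD : G (\bigcap_(x in [set` D])
      [set f : {ptws X -> R} | `|f x - h x| < e]).
    by apply: filter_bigI => x _; have /cvgrPdistC_lt/(_ e e0) := Gh x; exact.
  have [f [Ff Df]] := filter_ex (filterI (GF F (fun _ => id)) GD).
  by exists f.
(* Conversely, the sets [B (S, e)] generate a filter containing [F], proper by assumption; taking
   singletons for [S] makes it converge to [h] at each point. *)
pose D := [set p : set X * R | finite_set p.1 /\ 0 < p.2].
pose B (p : set X * R) := [set f : {ptws X -> R} |
  F f /\ forall x, p.1 x -> `|f x - h x| < p.2].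
have GF : Filter (filter_from D B).
  apply: filter_from_filter.
    by exists (set0, 1); split => /=; [exact: finite_set0|exact: ltr01].
  move=> [S d] [T e] [/= fS d0] [/= fT e0]; exists (S `|` T, Num.min d e).
    by split => /=; [rewrite finite_setU|rewrite lt_min d0].
  move=> f [Ff /= STf]; split; split=> //= x xS.
    by have := STf x (or_introl xS); rewrite lt_min => /andP[].
  by have := STf x (or_intror xS); rewrite lt_min => /andP[].
exists (filter_from D B).
  apply: filter_from_proper => -[S e] [/= fS e0].
  by have [f Ff fh] := Fh S e fS e0; exists f.
split; last first.
  move=> C FC; exists (set0, 1); last by move=> f [/FC].
  by split => /=; [exact: finite_set0|exact: ltr01].
apply/pointwise_cvgP => x C /nbhs_ballP[e /= e0 eC].
exists ([set x], e); first by split => //; exact: finite_set1.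
by move=> f [_ /= /(_ x erefl) fx]; apply: eC; rewrite /ball /= distrC.
Qed.

(** * Bounded upper semicontinuous functions *)

Section USC.
Variables (R : realType) (X : topologicalType).
Implicit Types f g h : X -> R.
Local Notation H := (@USC_bounded R X).
Local Notation zero := (cst 0 : X -> R).

Lemma USC_bounded_cst (c : R) : H (cst c).
Proof.
split; first by apply/bounded_fun_ex; exists `|c|.
move=> a; have [ca|ac] := ltP c a.
  by rewrite (_ : [set _ | _] = setT) ?predeqE//; exact: openT.
rewrite (_ : [set _ | _] = set0); first exact: open0.
by rewrite predeqE => x; split=> //=; rewrite ltNge ac.
Qed.

Lemma USC_boundedD f g : H f -> H g -> H (f \+ g).
Proof.
move=> [bf of_] [bg og]; split.
  by have := bounded_funD bf bg.
move=> a.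
(* The sum is below [a] exactly when some [q] satisfies [f x < q < a - g x]; the witness is the
   midpoint. *)
rewrite (_ : [set _ | _] =
    \bigcup_(q in [set: R]) ([set x | f x < q] `&` [set x | g x < a - q])).
  by apply: bigcup_open => q _; exact: openI.
rewrite predeqE => x; split=> /= [fga|[q _ [/= fq gq]]]; last by lra.
by exists (f x + (a - (f x + g x)) / 2) => //; split => /=; lra.
Qed.

Lemma funB0 f : f \- zero = f.
Proof. by apply/funext => x /=; rewrite subr0. Qed.

Lemma O_familiesE (F : set (X -> R)) :
  (forall f, F f -> H f /\ le_pointwise zero f) ->
  property_O zero F -> O_families zero H F.
Proof.
by move=> FH OF; split=> // [f /FH[]//|f /FH[? ?]]; rewrite funB0.
Qed.

Lemma closure0_ltP (B : set R) : (forall r, B r -> 0 <= r) ->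
  (forall e, 0 < e -> exists2 r, B r & r < e) -> closure B 0.
Proof.
move=> B0 Be C /nbhs_ballP[e /= e0 eC]; have [r Br re] := Be e e0.
exists r; split => //; apply: eC; rewrite /ball /= sub0r normrN.
by rewrite ger0_norm ?B0.
Qed.

(** * Raising a function off an open set, and upper density of [high_off] *)

Hypothesis X_T1 : accessible_space X.

(* [S `<=` U] is needed for [raise U S c f h \- f] to be upper semicontinuous:
   it may vanish at the points of [S], but equals [c] off [U]. *)
Definition raise (U S : set X) (c : R) (f h : X -> R) : X -> R :=
  fun x => if x \in S then h x else if x \in U then f x else f x + c.

(** The difference from [f] is [h x - f x] on [S], 0 on the rest of [U], and [c] elsewhere. For
    [a > 0] its sublevel set is the whole space or [U], according as [c < a] or not, minus the
    finite set [T] of points of [S] where the difference is at least [a]; [T] is closed by the T1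
    axiom. The raised function is then a sum of two members of [H]. *)
Lemma raise_spec U S c f h : open U -> finite_set S -> S `<=` U -> 0 <= c ->
  H f -> H h -> le_pointwise f h ->
  [/\ H (raise U S c f h), le_pointwise f (raise U S c f h) &
      H (raise U S c f h \- f)].
Proof.
move=> oU fS SU c0 Hf Hh fh; set g := raise U S c f h.
have Hd : H (g \- f).
  split.
    have [/bounded_fun_ex[M fM] _] := Hf; have [/bounded_fun_ex[N hN] _] := Hh.
    apply/bounded_fun_ex; exists (M + N + c) => x /=; rewrite /g /raise.
    have := fM x; have := hN x; rewrite !ler_norml.
    case: ifPn => _; last case: ifPn => _; move=> /andP[h1 h2] /andP[h3 h4];
      apply/andP; split; lra.
  move=> a; have [a0|a0] := leP a 0.
    rewrite (_ : [set _ | _] = set0); first exact: open0.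
    rewrite predeqE => x; split=> //=; rewrite /g /raise; have := fh x.
    case: ifPn => _; last case: ifPn => _; lra.
  pose T := S `&` [set x | a <= h x - f x].
  have fT : finite_set T by exact: finite_setIl.
  have oT : open (~` T).
    by apply: closed_openC; move/accessible_finite_set_closed : X_T1; exact.
  have [ca|ac] := ltP c a.
    rewrite (_ : [set _ | _] = ~` T)// predeqE => x.
    have := fh x; rewrite /T /g /raise /=.
    case: ifPn => [/set_mem Sx|/negP xS] fhx.
      split=> [? []|/not_andP[//|]]; first by lra.
      by move/negP; lra.
    split=> [_ [/mem_set//]|_]; case: ifPn => _; lra.
  rewrite (_ : [set _ | _] = U `&` ~` T); first exact: openI.
  rewrite predeqE => x; have := fh x.
  rewrite /T /g /raise /=; case: ifPn => [/set_mem Sx|/negP xS] fhx.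
    split=> [?|[_ /not_andP[//|/negP]]]; last by lra.
    by split; [exact: SU|move=> []; lra].
  case: ifPn => [/set_mem Ux|/negP xU]; split.
  - by move=> _; split=> // -[/mem_set].
  - by move=> _; lra.
  - by lra.
  - by move=> [/mem_set].
have gE : g = f \+ (g \- f) by apply/funext => x /=; lra.
split => //; first by rewrite gE; exact: USC_boundedD.
move=> x; rewrite /g /raise; have := fh x.
case: ifPn => _; last case: ifPn => _; lra.
Qed.

Definition high_off (U : set (set X)) : set (X -> R) :=
  [set h | H h /\ exists2 V, U V & forall x, ~ V x -> 1 <= h x].

Lemma lift_above1 f : H f -> exists2 c, 0 <= c & forall x, 1 <= f x + c.
Proof.
move=> [/bounded_fun_ex[M fM] _]; exists (`|M| + 1).
  by rewrite addr_ge0.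
move=> x; have := fM x; rewrite ler_norml => /andP[? _].
by have := ler_norm M; lra.
Qed.

Lemma raise_high_off (U : set (set X)) V S c f h :
  open V -> finite_set S -> S `<=` V -> U V -> H f -> H h -> le_pointwise f h ->
  0 <= c -> (forall x, 1 <= f x + c) -> high_off U (raise V S c f h).
Proof.
move=> oV fS SV UV Hf Hh fh c0 fc; split.
  by have [] := raise_spec oV fS SV c0 Hf Hh fh.
exists V => // x Vx; rewrite /raise; case: ifPn => [/set_mem/SV//|_].
by case: ifPn => [/set_mem//|_].
Qed.

(** Along an injective sequence [V] in [U], each point misses only finitely many [V n], so the
    functions raised off [V n] are eventually equal to [f] there. *)
Lemma upper_seq_dense_high_off (U : set (set X)) :
  open_gamma_covers X U -> upper_seq_dense H (high_off U).
Proof.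
move=> [oU [_ infU gU]]; split => [h []//|f Hf].
have /pcard_leP[V] := (infiniteP U).1 infU.
have UV n : U (V n) by exact: funS.
have [c c0 fc] := lift_above1 Hf.
have ff : le_pointwise f f by move=> x.
have fV n := raise_spec (oU _ (UV n)) (@finite_set0 X) (@sub0set _ _) c0 Hf Hf ff.
exists (fun n => raise (V n) set0 c f f); split.
- by move=> n; apply: raise_high_off => //; exact: oU.
- move=> x; apply: cvg_near_cst.
  have : finite_set (V @^-1` [set A | U A /\ ~ A x]).
    apply: finite_preimage => [m n _ _|]; last exact: gU.
    by apply: (@inj _ _ setT V); rewrite inE.
  move=> /near_notin_finite_set; apply: filterS => n Vnx.
  rewrite /raise in_set0; case: ifPn => // /negP xV.
  by exfalso; apply: Vnx; split => // /mem_set.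
- by move=> n; have [] := fV n.
Qed.

(** Some [V] in [U] contains the given finite [S], so the raised function can copy [h] on [S] with
    no error at all. *)
Lemma upper_dense_high_off (U : set (set X)) :
  open_omega_covers X U -> upper_dense H (high_off U).
Proof.
move=> [oU [_ _ wU]]; split => [h []//|f Hf h [Hh fh]].
apply/closure_pP => S e fS e0; have [V UV SV] := wU S fS.
have [c c0 fc] := lift_above1 Hf.
have [? ? ?] := raise_spec (oU _ UV) fS SV c0 Hf Hh fh.
exists (raise V S c f h); last first.
  by move=> x /mem_set xS; rewrite /raise xS subrr normr0.
by split => //; apply: raise_high_off => //; exact: oU.
Qed.

(** * From selections of functions to covers and back *)

Lemma covers_of_pointwise_dense (C : set (set (set X)))
    (D : set (set (X -> R))) :
  (forall U, C U -> open_family U) -> (forall U, C U -> D (high_off U)) ->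
  selection_S1 D (pointwise_dense H) -> selection_S1 C (open_covers X).
Proof.
move=> oC CD SD U CU; have [a [Ua [_ aR]]] := SD _ (fun n => CD _ (CU n)).
have [V VP] := choice2 (fun n => (Ua n).2).
exists V; split=> [n|]; first by have [] := VP n.
split=> [_ [n _ <-]|]; first by apply: oC (CU n) _ _; have [] := VP n.
rewrite /is_cover predeqE => x; split=> // _.
have : closure [set f x | f in range a] 0 by rewrite aR.
move=> /(_ _ (nbhsx_ballx 0 1 ltr01)) [_ [[_ [n _ <-] <-]]].
rewrite /ball /= sub0r normrN => ax1; exists (V n); first by exists n.
apply: contrapT => Vx; have [_ /(_ x Vx)] := VP n.
by have := ler_norm (a n x); lra.
Qed.

Lemma O_families_of_covers (C : set (set (set X)))
    (P : set (set (X -> R))) :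
  (forall F f, P F -> F f -> H f /\ le_pointwise zero f) ->
  (forall F e, P F -> 0 < e -> (exists2 f, F f & forall x, f x < e) \/
     C [set [set x | f x < e] | f in F]) ->
  selection_S1 C (open_covers X) -> selection_S1 P (O_families zero H).
Proof.
move=> PH PC SC F PF.
(* As all selected functions are nonnegative, satisfying every [Q k] puts 0 in the closure of the
   values at each point. *)
pose Q (k : nat) (B : set (X -> R)) := forall x, exists2 f, B f & f x < k.+1%:R^-1.
have [k|a Fa aP] := @selection_countable nat 0%N _ P Q _ F PF; last first.
  exists a; split=> //; apply: O_familiesE.
    by move=> _ [n _ <-]; exact: PH (PF n) (Fa n).
  move=> x; apply: closure0_ltP.
    move=> _ [_ [n _ <-] <-]; exact: (PH _ _ (PF n) (Fa n)).2.
  move=> e e0; have [k] := ltr_add_invr e0; rewrite add0r => ke.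
  have [B Ba /(_ x)[f Bf fk]] := aP k.
  by exists (f x); [exists f => //; exact: Ba|exact: lt_trans fk ke].
move=> {F PF} F PF.
have k0 : 0 < k.+1%:R^-1 :> R by rewrite invr_gt0.
have [[n [f Ff fk]]|nF] :=
    pselect (exists n, exists2 f, F n f & forall x, f x < k.+1%:R^-1).
  (* The other indices need some member too: if the sublevel sets of [F m] belong to [C], the
     principle for the constant sequence selects one of them, hence a function in [F m]. *)
  have [c Fc] : exists c : nat -> X -> R, forall n, F n (c n).
    suff /choice[c Fc] : forall m, exists g, F m g by exists c.
    move=> m; have [[g Fg _]|CF] := PC _ _ (PF m) k0; first by exists g.
    have [b [bF _]] := SC (fun=> _) (fun=> CF).
    by have [g Fg _] := bF 0%N; exists g.
  exists (fun m => if m == n then f else c m); split=> [m|x].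
    by case: eqP => [->|_].
  by exists f => //; exists n => //; rewrite eqxx.
have CF n : C [set [set x | f x < k.+1%:R^-1] | f in F n].
  have [[f Ff fk]|//] := PC _ _ (PF n) k0.
  by exfalso; apply: nF; exists n, f.
have [V [VF [_ Vcov]]] := SC _ CF.
have [a aP] := choice2 (fun n => VF n).
exists a; split=> [n|x]; first by have [] := aP n.
have : (\bigcup_(A in range V) A) x by rewrite Vcov.
move=> [_ [n _ <-]]; have [_ <- /= ax] := aP n.
by exists (a n) => //; exists n.
Qed.

Lemma Gamma_sublevel_cover (F : set (X -> R)) (e : R) :
  Gamma_families zero H F -> 0 < e ->
  (exists2 f, F f & forall x, f x < e) \/
  open_gamma_covers X [set [set x | f x < e] | f in F].
Proof.
move=> [FH [infF gF] _] e0.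
have [|nF] := pselect (exists2 f, F f & forall x, f x < e); first by left.
have finx x : finite_set [set f | F f /\ e <= f x].
  apply: sub_finite_set (gF e x e0) => f [Ff ef]; split => //.
  by rewrite subr0 (le_trans ef)// ler_norm.
right; split; first by move=> _ [f Ff <-]; exact: (FH _ Ff).2.
split.
- rewrite /is_cover predeqE => x; split=> // _.
  have [f [Ff /not_andP[//|/negP fx]]] :=
    infinite_setN0 (infinite_setD infF (finx x)).
  by exists [set x | f x < e]; [exists f|rewrite /= ltNge].
(* If the cover were finite, [F] would be a finite union of fibres. Each fibre is finite: its
   members share a sublevel set other than the whole space, so all are at least [e] at a common
   point. *)
- move=> fin; apply: infF.
  pose fibre (A : set X) := F `&` [set f | [set x | f x < e] = A].
  apply: (@sub_finite_set _ _
      (\bigcup_(A in [set [set x | f x < e] | f in F]) fibre A)).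
    by move=> f Ff; exists [set x | f x < e] => //; exists f.
  apply: bigcup_finite => // _ [f Ff <-].
  have [x fx] : exists x, e <= f x.
    apply: contrapT => /forallNP fe; apply: nF; exists f => // x.
    by rewrite ltNge; apply/negP.
  apply: sub_finite_set (finx x) => g [Fg gf]; split => //.
  rewrite leNgt; apply/negP => gx.
  have : [set x | f x < e] x by rewrite -gf.
  by rewrite /= ltNge fx.
- move=> x.
  apply: sub_finite_set (finite_image (fun f => [set x | f x < e]) (finx x)).
  move=> _ [[f Ff <-] /= /negP fx]; exists f => //; split => //.
  by rewrite leNgt.
Qed.

Lemma Omega_sublevel_cover (F : set (X -> R)) (e : R) :
  Omega_families zero H F -> 0 < e ->
  (exists2 f, F f & forall x, f x < e) \/
  open_omega_covers X [set [set x | f x < e] | f in F].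
Proof.
move=> [FH [_ /closure_pP cF] _] e0.
have [|nF] := pselect (exists2 f, F f & forall x, f x < e); first by left.
have wF S : finite_set S -> exists2 f, F f & forall x, S x -> f x < e.
  move=> fS; have [f Ff Sf] := cF S e fS e0; exists f => // x /Sf.
  by rewrite subr0; exact/le_lt_trans/ler_norm.
right; split; first by move=> _ [f Ff <-]; exact: (FH _ Ff).2.
split.
- rewrite /is_cover predeqE => x; split=> // _.
  have [f Ff fx] := wF [set x] (finite_set1 x).
  by exists [set x | f x < e]; [exists f|exact: fx].
- move=> [f Ff fT]; apply: nF; exists f => // x.
  by have : [set x | f x < e] x by rewrite fT.
- move=> S /wF[f Ff Sf]; exists [set x | f x < e] => //.
  by exists f.
Qed.

(** * Families clustering at 0 inside upper dense sets *)

Lemma O_families_of_subfamilies (P D : set (set (X -> R))) :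
  (forall A, D A -> exists2 f, A f & H f /\ le_pointwise zero f) ->
  (forall A, D A -> ~ A zero -> exists2 F, F `<=` A & P F) ->
  selection_S1 P (O_families zero H) -> selection_S1 D (O_families zero H).
Proof.
(* When some [A n] contains [zero], [D0] keeps the remaining choices nonnegative, as [O_families]
   demands; otherwise every [A n] is thinned to a member of [P]. *)
move=> D0 DP SP A DA; have [[n An0]|nA] := pselect (exists n, A n zero).
  have [c cP] := choice2 (fun m => D0 _ (DA m)).
  pose a m := if m == n then zero else c m.
  exists a; split=> [m|].
    by rewrite /a; case: eqP => [->//|_]; have [] := cP m.
  apply: O_familiesE => [_ [m _ <-]|x].
    rewrite /a; case: eqP => _; last by have [] := cP m.
    by split; [exact: USC_bounded_cst|move=> x].
  apply: subset_closure; exists (a n); first by exists n.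
  by rewrite /a eqxx.
have [F FP] := choice2 (fun n => DP _ (DA n) ((forallNP _).2 nA n)).
have [a [Fa aO]] := SP F (fun n => (FP n).2).
by exists a; split=> // n; exact: (FP n).1.
Qed.

Lemma Gamma_subfamily (A : set (X -> R)) :
  upper_seq_dense H A -> ~ A zero ->
  exists2 F, F `<=` A & Gamma_families zero H F.
Proof.
move=> [AH Ad] nA; have [h [Ah hcvg h0]] := Ad zero (USC_bounded_cst 0).
have hfin e x : 0 < e -> finite_set [set n | e <= `|h n x|].
  move=> e0; have /cvgrPdist_lt/(_ e e0)[N _ hN] := hcvg x.
  apply: sub_finite_set (finite_II N) => n /= ehn.
  rewrite ltnNge; apply/negP => /hN /=; rewrite sub0r normrN.
  by rewrite ltNge ehn.
exists (range h); first by move=> _ [n _ <-].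
split=> [_ [n _ <-]| |_ [n _ <-]]; [exact: AH| |exact: h0].
split=> [fin|e x e0]; last first.
  apply: sub_finite_set (finite_image h (hfin e x e0)).
  by move=> _ [[n _ <-]]; rewrite subr0 => ehn; exists n.
(* A finite range would split [nat] into finitely many fibres. Each is finite: [h n] is nonzero at
   some [x], and convergence to 0 at [x] allows this value only finitely often. *)
apply: (@infinite_nat).
apply: (@sub_finite_set _ _ (\bigcup_(g in range h) [set n | h n = g])).
  by move=> n _; exists (h n) => //; exists n.
apply: bigcup_finite => // _ [n _ <-].
have [x hx] : exists x, h n x != 0.
  apply: contrapT => /forallNP hn; apply: nA.
  suff <- : h n = zero by [].
  by apply/funext => x; have /negP := hn x; rewrite negbK => /eqP.
apply: sub_finite_set (hfin `|h n x| x _); last by rewrite normr_gt0.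
by move=> m /= ->.
Qed.

(** This is upper density with [f] and [h] both [zero]. *)
Lemma Omega_subfamily (A : set (X -> R)) :
  upper_dense H A -> ~ A zero ->
  exists2 F, F `<=` A & Omega_families zero H F.
Proof.
move=> [AH Ad] nA; have H0 := USC_bounded_cst 0.
exists [set h | [/\ A h, le_pointwise zero h & H (h \- zero)]].
  by move=> h [].
split=> [h [/AH]//| |h []//]; split; first by case.
by apply: Ad => //; split=> // x.
Qed.

Lemma upper_seq_dense_nonneg (A : set (X -> R)) : upper_seq_dense H A ->
  exists2 f, A f & H f /\ le_pointwise zero f.
Proof.
move=> [AH Ad]; have [h [Ah _ h0]] := Ad zero (USC_bounded_cst 0).
by exists (h 0%N) => //; split; [exact: AH|have [] := h0 0%N].
Qed.

Lemma upper_dense_nonneg (A : set (X -> R)) : upper_dense H A ->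
  exists2 f, A f & H f /\ le_pointwise zero f.
Proof.
move=> [AH Ad]; have H0 := USC_bounded_cst 0.
have /closure_pP : closure_p
    [set h | [/\ A h, le_pointwise zero h & H (h \- zero)]] zero.
  by apply: Ad => //; split=> // x.
move=> /(_ set0 1 (@finite_set0 _) ltr01) [f [Af f0 _] _].
by exists f => //; split => //; exact: AH.
Qed.

(** * Translation by constants and pointwise density *)

Definition shift (q : R) (A : set (X -> R)) : set (X -> R) :=
  [set g | A (g \+ cst q)].

Lemma shift_sub q A : A `<=` H -> shift q A `<=` H.
Proof.
move=> AH g /AH Hg; have := USC_boundedD Hg (USC_bounded_cst (- q)).
by congr (USC_bounded _); apply/funext => x /=; rewrite addrK.
Qed.

Lemma upper_seq_dense_shift q A :
  upper_seq_dense H A -> upper_seq_dense H (shift q A).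
Proof.
move=> [AH Ad]; split=> [|f Hf]; first exact: shift_sub.
have [h [Ah hcvg hf]] := Ad _ (USC_boundedD Hf (USC_bounded_cst q)).
exists (fun n => h n \- cst q); split=> [n|x|n].
- rewrite /shift /=.
  by have -> : (h n \- cst q) \+ cst q = h n by apply/funext => x /=; rewrite subrK.
- rewrite -[f x](addrK q); apply: cvgB; [exact: hcvg|exact: cvg_cst].
- have [le_fh Hh] := hf n; split=> [x|].
    by have := le_fh x => /=; lra.
  by move: Hh; congr (USC_bounded _); apply/funext => x /=; lra.
Qed.

Lemma upper_dense_shift q A : upper_dense H A -> upper_dense H (shift q A).
Proof.
move=> [AH Ad]; split=> [|f Hf h [Hh fh]]; first exact: shift_sub.
have Hq := USC_bounded_cst q.
have /closure_pP hA : closure_p [set g | [/\ A g, le_pointwise (f \+ cst q) g &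
    H (g \- (f \+ cst q))]] (h \+ cst q).
  apply: Ad; first exact: USC_boundedD.
  by split=> [|x]; [exact: USC_boundedD|rewrite /= lerD2r].
apply/closure_pP => S e fS e0; have [g [Ag fg Hg] gh] := hA S e fS e0.
exists (g \- cst q); last first.
  by move=> x /gh /=; congr (`|_| < _); lra.
split.
- rewrite /shift /=.
  by have -> : (g \- cst q) \+ cst q = g by apply/funext => x /=; rewrite subrK.
- by move=> x; have := fg x => /=; lra.
- by move: Hg; congr (USC_bounded _); apply/funext => x /=; lra.
Qed.

(** A selection from the families [shift (ratr q) (A n)] clusters at 0; adding [q] back lands in
    [A n] and clusters at [q]. Carrying this out for all rational [q] within one sequence gives
    density. *)
Lemma pointwise_dense_of_O_families (D : set (set (X -> R))) :
  (forall A, D A -> A `<=` H) -> (forall q A, D A -> D (shift q A)) ->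
  selection_S1 D (O_families zero H) -> selection_S1 D (pointwise_dense H).
Proof.
move=> DH Dshift SD A DA.
pose Q (q : rat) (B : set (X -> R)) :=
  forall x, closure [set f x | f in B] (ratr q).
have [q|a Aa aP] := @selection_countable rat 0 _ D Q _ A DA; last first.
  exists a; split=> //; split=> [_ [n _ <-]|x]; first exact: DH (DA n) _ (Aa n).
  rewrite predeqE => r; split=> // _ C /nbhs_ballP[e /= e0 eC].
  have [q] : exists q : rat, ratr q \in `]r - e, r + e[.
    by apply: rat_in_itvoo; lra.
  rewrite in_itv /= => /andP[rq qr]; have [B Ba Bq] := aP q.
  (* The ball about [q] of radius [e] minus the distance from [r] to [q] stays inside the [e]-ball
     about [r]. *)
  have : nbhs (ratr q : R) C.
    apply/nbhs_ballP; exists (e - `|r - ratr q|) => /=.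
      by rewrite subr_gt0 ltr_norml; apply/andP; split; lra.
    move=> t; rewrite /ball /= => qt; apply: eC; rewrite /ball /=.
    by have := ler_distD (ratr q) r t; lra.
  by move=> /(Bq x) [_ [[f Bf <-] Cf]]; exists (f x); split=> //; exists f => //; exact: Ba.
move=> {A DA} A DA.
have [b [Ab [_ bO _]]] := SD _ (fun n => Dshift (ratr q) _ (DA n)).
exists (fun n => b n \+ cst (ratr q)); split=> // x C /nbhs_ballP[e /= e0 eC].
have [_ [[_ [n _ <-] <-] bn]] := bO x _ (nbhsx_ballx 0 e e0).
exists (b n x + ratr q); split; first by exists (b n \+ cst (ratr q)) => //; exists n.
apply: eC; move: bn; rewrite /ball /= => bn.
by rewrite (_ : _ - _ = 0 - b n x)//; lra.
Qed.

End USC.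

(** * The two cycles of implications *)

Theorem theorem7p1 (R : realType) (X : topologicalType)
    (X_inf : infinite_set [set: X]) (X_T2 : hausdorff_space X) :
  let H := @USC_bounded R X in
  let zero : X -> R := cst 0 in
  [<-> selection_S1 (upper_seq_dense H) (pointwise_dense H);
       selection_S1 (open_gamma_covers X) (open_covers X);
       selection_S1 (Gamma_families zero H) (O_families zero H);
       selection_S1 (upper_seq_dense H) (O_families zero H)]
  /\
  (property_epsilon X ->
   [<-> selection_S1 (upper_dense H) (pointwise_dense H);
        selection_S1 (open_omega_covers X) (open_covers X);
        selection_S1 (Omega_families zero H) (O_families zero H);
        selection_S1 (upper_dense H) (O_families zero H)]).
Proof.
have X_T1 := hausdorff_accessible X_T2; move=> H zero; split=> [|_].
  tfae.
  - apply: covers_of_pointwise_dense => U; first by case.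
    exact: upper_seq_dense_high_off.
  - apply: O_families_of_covers; last by move=> F e; exact: Gamma_sublevel_cover.
    by move=> F f [FH _ F0] Ff; split; [exact: FH|exact: (F0 f Ff).1].
  - apply: O_families_of_subfamilies; first exact: upper_seq_dense_nonneg.
    exact: Gamma_subfamily.
  - apply: pointwise_dense_of_O_families; first by move=> A [].
    exact: upper_seq_dense_shift.
tfae.
- apply: covers_of_pointwise_dense => U; first by case.
  exact: upper_dense_high_off.
- apply: O_families_of_covers; last by move=> F e; exact: Omega_sublevel_cover.
  by move=> F f [FH _ F0] Ff; split; [exact: FH|exact: (F0 f Ff).1].
- apply: O_families_of_subfamilies; first exact: upper_dense_nonneg.
  exact: Omega_subfamily.
- apply: pointwise_dense_of_O_families; first by move=> A [].
  exact: upper_dense_shift.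
Qed.
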